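(* Let $k\ge2$ be an integer. There exist polynomials $g_{k,\ell}$ in one variable ($0\le\ell< k$, depending only on $k$ and $\ell$) such that for all real $c$ with $0\le c\le k$, $$\gamma_k(c)=\sum_{0\le\ell<c}\binom{k}{\ell}^2(c-\ell)^{(k-\ell)^2+\ell^2-1}\,g_{k,\ell}(c-\ell),$$ where the sum runs over integers $\ell$ with $0\le\ell<c$.
   Context: The function $\gamma_k$ is $$\gamma_k(c)=\frac{1}{k!\,G(1+k)^2}\int_{[0,1]^k}\delta_c(w_1+\cdots+w_k)\prod_{i<j}(w_i-w_j)^2\,d^kw,$$ where $\delta_c(x)=\delta(x-c)$ is the delta distribution translated by $c$, and $G$ is the Barnes $G$-function, so $G(1+k)=1!\cdot2!\cdots(k-1)!$. Concretely, the integral means the integral of $\prod_{1\le i<j\le k}(w_i-w_j)^2$ with $w_k:=c-w_1-\cdots-w_{k-1}$, with respect to Lebesgue measure $dw_1\cdots dw_{k-1}$ over the set of $(w_1,\dots,w_{k-1})\in[0,1]^{k-1}$ for which $0\le w_k\le1$. *)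

(* Defs.v *)
From HB Require Import structures.
From mathcomp Require Import all_boot all_order all_algebra.
From mathcomp Require Import all_classical all_reals all_analysis.

Set Implicit Arguments.
Unset Strict Implicit.
Unset Printing Implicit Defensive.

Import Order.TTheory GRing.Theory Num.Theory.
Import numFieldNormedType.Exports.

Local Open Scope classical_set_scope.
Local Open Scope ring_scope.

(* The points of R^n, with the Borel sigma-algebra that the library puts on
   tuples of reals. *)
Notation Rn R n := (n.-tuple (measurableTypeR R)).

Section lebesgue_cons.
Context (R : realType) (n : nat).
Variable m : {sigma_finite_measure set (Rn R n) -> \bar R}.
Local Open Scope ereal_scope.

Definition cons_Rn (p : measurableTypeR R * Rn R n) : Rn R n.+1 :=
  [tuple of p.1 :: p.2].

Lemma measurable_cons_Rn : measurable_fun setT cons_Rn.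
Proof. exact: measurable_cons. Qed.

HB.instance Definition _ :=
  @isMeasurableFun.Build _ _ _ _ cons_Rn measurable_cons_Rn.

Definition lebesgue_cons : set (Rn R n.+1) -> \bar R :=
  pushforward (@lebesgue_measure R \x m) cons_Rn.

Let lebesgue_cons0 : lebesgue_cons set0 = 0.
Proof. exact: measure0. Qed.

Let lebesgue_cons_ge0 A : 0 <= lebesgue_cons A.
Proof. exact: measure_ge0. Qed.

Let lebesgue_cons_sigma_additive : semi_sigma_additive lebesgue_cons.
Proof. exact: measure_semi_sigma_additive. Qed.

HB.instance Definition _ := isMeasure.Build _ _ _ lebesgue_cons
  lebesgue_cons0 lebesgue_cons_ge0 lebesgue_cons_sigma_additive.

Lemma lebesgue_cons_sigma_finite : sigma_finite setT lebesgue_cons.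
Proof.
have /sigma_finiteP[F [TF ndF Foo]] := sigma_finiteT (@lebesgue_measure R).
have /sigma_finiteP[G [TG ndG Goo]] := sigma_finiteT m.
exists (fun i => [set w : Rn R n.+1 |
    F i (thead w) /\ G i [tuple of behead w]]).
  apply/esym/seteqP; split=> // w _.
  have [i _ Fi] : (\bigcup_i F i) (thead w) by rewrite -TF.
  have [j _ Gj] : (\bigcup_i G i) [tuple of behead w] by rewrite -TG.
  exists (maxn i j) => //; split.
    by move: (thead w) Fi; exact/subsetPset/ndF/leq_maxl.
  by move: [tuple of behead w] Gj; exact/subsetPset/ndG/leq_maxr.
move=> i; have [mF Fi_fin] := Foo i; have [mG Gi_fin] := Goo i; split.
  apply: measurableI; rewrite -[X in measurable X]setTI.
    exact: (measurable_tnth ord0).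
  exact: measurable_behead.
rewrite /lebesgue_cons /pushforward.
rewrite (_ : _ @^-1` _ = F i `*` G i); last first.
  apply/seteqP; split=> -[x w] /= [Fx Gw]; split=> //.
    by rewrite (_ : w = [tuple of behead (x :: w)]) //; exact/val_inj.
  by rewrite (_ : [tuple of _] = w) //; exact/val_inj.
by rewrite product_measure1E// lte_mul_pinfty// ge0_fin_numE.
Qed.

HB.instance Definition _ := @Measure_isSigmaFinite.Build _ _ _
  lebesgue_cons lebesgue_cons_sigma_finite.

End lebesgue_cons.

Fixpoint lebesgue_Rn (R : realType) (n : nat) :
    {sigma_finite_measure set (Rn R n) -> \bar R} :=
  match n with
  | 0 => dirac ([tuple] : Rn R 0)
  | n'.+1 => lebesgue_cons (lebesgue_Rn R n')
  end.

Lemma lebesgue_Rn_box (R : realType) n (A : 'I_n -> set (measurableTypeR R)) :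
  (forall i, measurable (A i)) ->
  lebesgue_Rn R n [set w | forall i, A i (tnth w i)] =
  (\prod_(i < n) lebesgue_measure (A i))%E.
Proof.
elim: n A => [|n IHn] A mA.
  rewrite big_ord0 /= diracE mem_set //; by case.
rewrite big_ord_recl -IHn //= /lebesgue_cons /pushforward.
rewrite -product_measure1E //; last first.
  rewrite (_ : [set _ | _] =
      \bigcap_(i in [set: 'I_n]) ((@tnth n _)^~ i @^-1` A (lift ord0 i))).
    apply: fin_bigcap_measurable; first exact: finite_finset.
    move=> i _; rewrite -[X in measurable X]setTI.
    exact: measurable_tnth.
  apply/seteqP; split=> [w Aw i _ //|w Aw i]; exact: Aw.
congr product_measure1; apply/seteqP; split=> -[x w] /=.
  move=> Aw; split; first by have := Aw ord0.
  by move=> i; have := Aw (lift ord0 i); rewrite tnthS.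
by case=> Ax Aw i; case: (unliftP ord0 i) => [j ->|->] //; rewrite tnthS.
Qed.

(* The Barnes G-function at natural numbers, G(1 + k) = 1! 2! ... (k - 1)!,
   with G(0) = 0. *)
Definition barnesG (n : nat) : nat :=
  if n is k.+1 then \prod_(1 <= j < k) j`! else 0.

Section gamma.
Context (R : realType).

(* From w = (w_1, ..., w_n), the point (w_1, ..., w_n, c - w_1 - ... - w_n) of
   the hyperplane where the coordinates sum to c; this is what the factor
   delta_c(w_1 + ... + w_(n+1)) leaves after integrating out the last
   coordinate. *)
Definition on_hyperplane (n : nat) (c : R) (w : Rn R n) : seq R :=
  rcons w (c - \sum_(i < n) tnth w i).

Definition cube_slice (n : nat) (c : R) : set (Rn R n) :=
  [set w | forall x, x \in on_hyperplane c w -> 0 <= x <= 1].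

Definition vandermonde_sqr (k : nat) (s : seq R) : R :=
  \prod_(j < k) \prod_(i < k | (i < j)%N) (s`_i - s`_j) ^+ 2.

Definition gamma (k : nat) (c : R) : R :=
  ((k`!)%:R * (barnesG k.+1)%:R ^+ 2)^-1 *
  \int[lebesgue_Rn R k.-1]_(w in cube_slice c)
    vandermonde_sqr k (on_hyperplane c w).

End gamma.

(* Main.v *)
Require Import Defs.
From mathcomp Require Import all_boot all_order all_algebra.
From mathcomp Require Import all_classical all_reals all_analysis.
From mathcomp Require Import measurable_realfun ring lra.
Import Order.TTheory GRing.Theory Num.Theory.
Local Open Scope ring_scope.

(** The formula is an inclusion-exclusion over the faces of the cube.  Write
    the indicator of [0, 1] as 1_(x >= 0) - 1_(x > 1) and expand the product
    over the k coordinates: the integral over the slice of the cube is an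
    alternating sum, over the sets S of coordinates, of integrals of the
    squared Vandermonde over the corner where w_i > 1 for i in S and w_i >= 0
    for the others ([restrict_corner], [Rintegral_cube_slice]).

    Fix S, let l = #|S| and t = c - l, and substitute w_i = 1_(i in S) + t y_i.
    If t > 0 the corner becomes a simplex in y, on the hyperplane where the
    coordinates sum to 1, that does not depend on c.  A difference w_i - w_j
    becomes t (y_i - y_j) when i and j are on the same side of S, and
    t (y_i - y_j) +- 1 otherwise.  So the squared Vandermonde is a power of t
    times a polynomial in t whose coefficients are bounded functions of y, and
    integrating over the simplex leaves a polynomial in t.  The power is
    t^(k - 1) from the Jacobian times t^2 for each pair on the same side, that
    is, t^((k - l)^2 + l^2 - 1) ([sum_same_side_pairs], [Rintegral_corner]).

    If t <= 0 the corner is empty, except that for l = 0 and c = 0 it is the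
    origin, where the Vandermonde vanishes because k >= 2; so the term of S is
    0 ([vandermonde_corner_eq0]).  Since c <= k this disposes of l = k as well
    as of every l >= c.  Grouping the sets S by cardinality yields the
    g_(k, l), which absorb the signs, the normalization of gamma and the
    inverse squared binomials. *)

Set Implicit Arguments.
Unset Strict Implicit.
Unset Printing Implicit Defensive.
Import numFieldNormedType.Exports.
Local Open Scope classical_set_scope.

(** * Affine changes of variables in Lebesgue integrals *)

Lemma measurable_affine (R : realType) (a t : R) :
  measurable_fun [set: measurableTypeR R]
    (fun x => a + t * x : measurableTypeR R).
Proof. by apply: measurable_funD => //; exact: measurable_funM. Qed.

Section lebesgue_affine.
Context (R : realType) (a t : R) (t_gt0 : 0 < t).

Let lebesgue_pushforward : {measure set (measurableTypeR R) -> \bar R} :=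
  measure_function_pushforward__canonical__measure_function_Measure
    (@lebesgue_measure R) (measurable_affine a t).
Let scaled_lebesgue : {measure set (measurableTypeR R) -> \bar R} :=
  mscale (NngNum (ltW t_gt0)) lebesgue_pushforward.

(** It suffices to compare the two measures on half-open intervals, where both
    are lengths. *)
Let lebesgue_measure_affine (A : set (measurableTypeR R)) : measurable A ->
  lebesgue_measure A = scaled_lebesgue A.
Proof.
apply: lebesgue_measure_unique => _ [[u v] _ <-] /=.
rewrite /mscale/= /pushforward.
have -> : (fun x => a + t * x) @^-1` `]u, v] = `](u - a) / t, (v - a) / t].
  apply/seteqP; split => x /=; rewrite !in_itv/= ltr_pdivrMr// ler_pdivlMr//;
  by rewrite ltrBlDl lerBrDl [x * t]mulrC.
rewrite !lebesgue_measure_itv /= !lte_fin ltr_pM2r ?invr_gt0// ltrD2r.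
case: ifPn => _; last by rewrite mule0.
rewrite -!EFinB -EFinM; congr (_%:E).
by rewrite -mulrBl mulrC divfK ?gt_eqF// opprB addrA subrK.
Qed.

Lemma ge0_integral_affine (f : measurableTypeR R -> \bar R) :
  measurable_fun setT f -> (forall x, 0 <= f x)%E ->
  (\int[lebesgue_measure]_x f x =
   t%:E * \int[lebesgue_measure]_x f (a + t * x)%R)%E.
Proof.
move=> mf f0; rewrite (eq_measure_integral scaled_lebesgue).
  rewrite ge0_integral_mscale// ge0_integral_pushforward//.
  exact: measurable_affine.
by move=> A mA _; exact: lebesgue_measure_affine.
Qed.
End lebesgue_affine.

Definition affine_Rn (R : realType) n (a : 'I_n -> R) (t : R) (y : Rn R n) :
  Rn R n := [tuple a i + t * tnth y i | i < n].

Lemma measurable_affine_Rn (R : realType) n (a : 'I_n -> R) (t : R) :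
  measurable_fun setT (affine_Rn a t).
Proof.
apply/measurable_fun_tnthP => i.
rewrite (_ : _ \o _ = (fun y => a i + t * tnth y i)).
  exact: (measurableT_comp (measurable_affine (a i) t) (measurable_tnth i)).
by apply/funext => y /=; rewrite tnth_mktuple.
Qed.

Lemma ge0_integral_lebesgue_cons (R : realType) n
    (m : {sigma_finite_measure set (Rn R n) -> \bar R})
    (f : Rn R n.+1 -> \bar R) :
  measurable_fun setT f -> (forall w, 0 <= f w)%E ->
  (\int[lebesgue_cons m]_w f w =
   \int[lebesgue_measure]_x \int[m]_w f (cons_Rn (x, w)))%E.
Proof.
move=> mf f0; rewrite ge0_integral_pushforward//.
  rewrite fubini_tonelli1 //.
  by apply: measurableT_comp => //; exact: measurable_cons_Rn.
by move=> p; exact: f0.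
Qed.

(** The measure on R^n is an iterated product, so Tonelli reduces the change of
    variables to the one-dimensional one, coordinate by coordinate.  For
    nonnegative functions no integrability has to be carried along. *)
Lemma ge0_integral_affine_Rn (R : realType) n (a : 'I_n -> R) (t : R)
    (f : Rn R n -> \bar R) :
  0 < t -> measurable_fun setT f -> (forall w, 0 <= f w)%E ->
  (\int[lebesgue_Rn R n]_w f w =
   (t ^+ n)%:E * \int[lebesgue_Rn R n]_y f (affine_Rn a t y))%E.
Proof.
move=> t0; elim: n a f => [|n IHn] a f mf f0.
  rewrite expr0 mul1e /=; apply: eq_integral => w _; congr f.
  by rewrite [LHS]tuple0 [RHS]tuple0.
rewrite /= ge0_integral_lebesgue_cons// ge0_integral_lebesgue_cons//; last first.
  exact: measurableT_comp (measurable_affine_Rn _ _).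
pose b i := a (lift ord0 i).
pose g (p : measurableTypeR R * Rn R n) :=
  f (cons_Rn (p.1, affine_Rn b t p.2)).
have mg : measurable_fun setT g.
  apply: measurableT_comp => //; apply: measurable_cons => /=.
    exact: measurable_fst.
  exact: (measurableT_comp (measurable_affine_Rn b t) measurable_snd).
transitivity (\int[lebesgue_measure]_x
    ((t ^+ n)%:E * \int[lebesgue_Rn R n]_y g (x, y)))%E.
  apply: eq_integral => x _; rewrite (IHn b) //.
  by apply: (measurableT_comp mf); apply: measurable_cons => /=.
have tn0 : 0 <= t ^+ n by rewrite exprn_ge0// ltW.
have mF : measurable_fun setT
    (fun x : measurableTypeR R => \int[lebesgue_Rn R n]_y g (x, y))%E.
  by apply: (measurable_fun_fubini_tonelli_F _ mg) => p; exact: f0.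
rewrite ge0_integralZl_EFin//; last first.
  by move=> x _; apply: integral_ge0 => y _; exact: f0.
rewrite [X in (_ * X)%E = _](ge0_integral_affine (a ord0) t0) //; last first.
  by move=> x; apply: integral_ge0 => y _; exact: f0.
rewrite muleA -EFinM -exprSr; congr (_ * _)%E.
apply: eq_integral => x _; apply: eq_integral => y _; congr f.
apply: eq_from_tnth => i; rewrite tnth_mktuple.
case: (unliftP ord0 i) => [j ->|->] /=.
  by rewrite !tnthS tnth_mktuple.
by rewrite !tnth0.
Qed.

Lemma Rintegral_affine_Rn (R : realType) n (a : 'I_n -> R) (t : R)
    (D : set (Rn R n)) (f : Rn R n -> R) :
  0 < t -> measurable D -> measurable_fun setT f -> (forall w, 0 <= f w) ->
  \int[lebesgue_Rn R n]_(w in D) f w =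
  t ^+ n * \int[lebesgue_Rn R n]_(y in affine_Rn a t @^-1` D)
             f (affine_Rn a t y).
Proof.
move=> t0 mD mf f0; rewrite /Rintegral integral_mkcond.
rewrite (ge0_integral_affine_Rn a t0); last 2 first.
- apply/(measurable_restrictT _ mD); apply: measurable_funTS.
  exact/measurable_EFinP.
- by move=> w; apply: erestrict_ge0 => x _; rewrite lee_fin.
rewrite [in RHS]integral_mkcond.
rewrite (_ : (fun y => _) = (fun y => (f (affine_Rn a t y))%:E)
    \_ (affine_Rn a t @^-1` D)); last first.
  by apply/funext => y; rewrite !patchE; congr (if _ then _ else _).
have tn0 : 0 < t ^+ n by rewrite exprn_gt0.
(* The two infinite values have real part 0, so the equation survives taking
   real parts even when the integral diverges. *)
set I := (\int[_]_x _)%E; case: I => [r| |] //=.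
  by rewrite gt0_muley ?lte_fin//= mulr0.
by rewrite gt0_muleNy ?lte_fin//= mulr0.
Qed.

(** * Integrating a polynomial whose coefficients depend on a point *)

Section bounded_measurable.
Context d (T : measurableType d) (R : realType).
Context (mu : {measure set T -> \bar R}) (D : set T).

(** On a set of finite measure these functions are integrable, and unlike the
    integrable functions they are stable under products. *)
Definition bounded_measurable (f : T -> R) : Prop :=
  measurable_fun D f /\ exists M, forall x, D x -> `|f x| <= M.

Lemma bounded_measurable_cst r : bounded_measurable (fun=> r).
Proof. by split; [exact: measurable_cst|exists `|r|]. Qed.

Lemma bounded_measurableD f g : bounded_measurable f -> bounded_measurable g ->
  bounded_measurable (fun x => f x + g x).
Proof.
move=> [mf [M fM]] [mg [N gN]]; split; first exact: measurable_funD.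
exists (M + N) => x Dx; apply: (le_trans (ler_normD _ _)).
by rewrite lerD ?fM ?gN.
Qed.

Lemma bounded_measurableM f g : bounded_measurable f -> bounded_measurable g ->
  bounded_measurable (fun x => f x * g x).
Proof.
move=> [mf [M fM]] [mg [N gN]]; split; first exact: measurable_funM.
by exists (M * N) => x Dx; rewrite normrM ler_pM ?fM ?gN.
Qed.

Lemma bounded_measurableB f g : bounded_measurable f -> bounded_measurable g ->
  bounded_measurable (fun x => f x - g x).
Proof.
move=> bf bg; rewrite (_ : (fun x => _) = fun x => f x + -1 * g x).
  apply: bounded_measurableD bf _.
  exact: bounded_measurableM (bounded_measurable_cst _) bg.
by apply/funext => x; rewrite mulN1r.
Qed.

Lemma bounded_measurable_sum I (r : seq I) (P : pred I) (f : I -> T -> R) :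
  (forall i, P i -> bounded_measurable (f i)) ->
  bounded_measurable (fun x => \sum_(i <- r | P i) f i x).
Proof.
move=> bf; elim: r => [|i r IHr].
  under eq_fun do rewrite big_nil; exact: bounded_measurable_cst.
under eq_fun do rewrite big_cons.
by case: (boolP (P i)) => // Pi; apply: bounded_measurableD => //; exact: bf.
Qed.

Lemma bounded_measurable_prod I (r : seq I) (P : pred I) (f : I -> T -> R) :
  (forall i, P i -> bounded_measurable (f i)) ->
  bounded_measurable (fun x => \prod_(i <- r | P i) f i x).
Proof.
move=> bf; elim: r => [|i r IHr].
  under eq_fun do rewrite big_nil; exact: bounded_measurable_cst.
under eq_fun do rewrite big_cons.
by case: (boolP (P i)) => // Pi; apply: bounded_measurableM => //; exact: bf.
Qed.

Lemma bounded_measurable_integrable f :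
  measurable D -> (mu D < +oo)%E -> bounded_measurable f ->
  mu.-integrable D (EFin \o f).
Proof.
move=> mD Doo [mf [M fM]]; apply: measurable_bounded_integrable => //.
exists M; split; first exact: num_real.
by move=> N MN x Dx; apply: le_trans (ltW MN); exact: fM.
Qed.

Lemma Rintegral_sum I (r : seq I) (f : I -> T -> R) : measurable D ->
  (forall i, mu.-integrable D (EFin \o f i)) ->
  \int[mu]_(x in D) (\sum_(i <- r) f i x) =
  \sum_(i <- r) \int[mu]_(x in D) f i x.
Proof.
move=> mD fi; elim: r => [|i r IHr].
  under eq_Rintegral do rewrite big_nil.
  by rewrite big_nil Rintegral_cst// mul0r.
under eq_Rintegral do rewrite big_cons.
rewrite big_cons RintegralD ?IHr//.
rewrite (_ : EFin \o _ = fun x => \sum_(j <- r) (f j x)%:E)%E.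
  by apply: integrable_sum => // j _; exact: fi.
by apply/funext => x /=; rewrite sumEFin.
Qed.

(** The uniform bound on the sizes lets one sum over a fixed range of
    coefficients when the polynomials are integrated. *)
Definition poly_family (F : T -> {poly R}) : Prop :=
  (exists N, forall x, (size (F x) <= N)%N) /\
  forall m, bounded_measurable (fun x => (F x)`_m).

Lemma poly_family_affine f g :
  bounded_measurable f -> bounded_measurable g ->
  poly_family (fun x => (f x) *: 'X + (g x)%:P).
Proof.
move=> bf bg; split.
  exists 2%N => x; rewrite (leq_trans (size_polyD _ _))// geq_max.
  rewrite (leq_trans (size_scale_leq _ _)) ?size_polyX//.
  by rewrite (leq_trans (size_polyC_leq1 _)).
move=> m; under eq_fun do rewrite coefD coefZ coefX coefC.
apply: bounded_measurableD.
  exact: bounded_measurableM bf (bounded_measurable_cst _).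
by case: (m == 0%N) => //; exact: bounded_measurable_cst.
Qed.

Lemma poly_familyM F G : poly_family F -> poly_family G ->
  poly_family (fun x => F x * G x).
Proof.
move=> [[M FM] bF] [[N GN] bG]; split.
  exists (M + N)%N => x; apply: (leq_trans (size_polyMleq _ _)).
  by apply: (leq_trans (leq_pred _)); exact: leq_add.
move=> m; under eq_fun do rewrite coefM.
by apply: bounded_measurable_sum => i _; exact: bounded_measurableM.
Qed.

Lemma poly_family_prod I (r : seq I) (P : pred I) (F : I -> T -> {poly R}) :
  (forall i, P i -> poly_family (F i)) ->
  poly_family (fun x => \prod_(i <- r | P i) F i x).
Proof.
move=> bF; elim: r => [|i r IHr].
  under eq_fun do rewrite big_nil.
  split; first by exists 1%N => x; rewrite size_poly1.
  by move=> m; exact: bounded_measurable_cst.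
under eq_fun do rewrite big_cons.
by case: (boolP (P i)) => // Pi; apply: poly_familyM => //; exact: bF.
Qed.

Lemma bounded_measurable_horner F t : poly_family F ->
  bounded_measurable (fun x => (F x).[t]).
Proof.
move=> [[N FN] bF].
under eq_fun do rewrite (horner_coef_wide _ (FN _)).
apply: bounded_measurable_sum => i _.
exact: bounded_measurableM (bF i) (bounded_measurable_cst _).
Qed.

(** Integrating coefficient by coefficient: evaluation at [t] is a finite linear
    combination, over a range independent of the point, of the coefficients. *)
Lemma Rintegral_poly_family F :
  measurable D -> (mu D < +oo)%E -> poly_family F ->
  exists G : {poly R}, forall t, \int[mu]_(x in D) (F x).[t] = G.[t].
Proof.
move=> mD Doo [[N FN] bF].
exists (\poly_(m < N) \int[mu]_(x in D) (F x)`_m) => t.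
rewrite horner_poly.
under eq_Rintegral do rewrite (horner_coef_wide _ (FN _)).
rewrite Rintegral_sum//.
  apply: eq_bigr => i _; rewrite RintegralZr//.
  exact: bounded_measurable_integrable.
move=> i; apply: bounded_measurable_integrable => //.
exact: bounded_measurableM (bF i) (bounded_measurable_cst _).
Qed.

End bounded_measurable.

(** * Corners of a hyperplane and inclusion-exclusion *)

Section hyperplane.
Context (R : realType) (n : nat).
Implicit Types (c r t : R) (w y : Rn R n) (S : {set 'I_n.+1}).

Definition hcoord c w (i : 'I_n.+1) : R := (on_hyperplane c w)`_i.

Lemma ord_widen_or_max (i : 'I_n.+1) :
  (exists j, i = widen_ord (leqnSn n) j) \/ i = ord_max.
Proof.
case: (unliftP ord_max i) => [j ->|->]; [left|by right].
by exists j; apply/val_inj; rewrite /= /bump leqNgt ltn_ord.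
Qed.

Lemma hcoord_widen c w (i : 'I_n) :
  hcoord c w (widen_ord (leqnSn n) i) = tnth w i.
Proof. by rewrite /hcoord nth_rcons size_tuple /= ltn_ord (tnth_nth 0). Qed.

Lemma hcoord_max c w : hcoord c w ord_max = c - \sum_(i < n) tnth w i.
Proof. by rewrite /hcoord nth_rcons size_tuple ltnn eqxx. Qed.

Lemma hcoordP c w (P : R -> Prop) :
  (forall x, x \in on_hyperplane c w -> P x) <-> forall i, P (hcoord c w i).
Proof.
have szw : size (on_hyperplane c w) = n.+1 by rewrite size_rcons size_tuple.
split=> [Pw i|Pw x /(nthP 0)[i]].
  by apply/Pw/mem_nth; rewrite szw.
by rewrite szw => ltin <-; exact: (Pw (Ordinal ltin)).
Qed.

Lemma sum_hcoord c w : \sum_i hcoord c w i = c.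
Proof.
rewrite big_ord_recr hcoord_max /= addrC.
by under [X in _ + X]eq_bigr do rewrite hcoord_widen; rewrite subrK.
Qed.

(** The last coordinate, although determined by the others, transforms by the
    same rule as they do provided that the constant of the hyperplane is
    transformed accordingly. *)
Lemma hcoord_affine c t (a : 'I_n.+1 -> R) y i :
  hcoord (\sum_i a i + t * c)
    (affine_Rn (fun j => a (widen_ord (leqnSn n) j)) t y) i =
  a i + t * hcoord c y i.
Proof.
case: (ord_widen_or_max i) => [[i' ->]|->].
  by rewrite !hcoord_widen tnth_mktuple.
rewrite !hcoord_max big_ord_recr /=.
under [X in _ - X]eq_bigr do rewrite tnth_mktuple.
rewrite big_split /= -mulr_sumr mulrBr; ring.
Qed.

Lemma measurable_hcoord c i : measurable_fun setT (hcoord c ^~ i).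
Proof.
case: (ord_widen_or_max i) => [[i' ->]|->].
  under eq_fun do rewrite hcoord_widen; exact: measurable_tnth.
under eq_fun do rewrite hcoord_max.
apply: measurable_funB => //; apply: measurable_sum => j.
exact: measurable_tnth.
Qed.

(** The threshold [r] makes one definition serve twice: [r = 1] gives the terms
    of the inclusion-exclusion, and [r = 0] what they become once the
    coordinates in [S] are translated by 1.  The inequality is strict on [S]
    because [1 < x] is the negation of [x <= 1]; the decomposition of the cube
    is then an exact identity, with no null sets to discard. *)
Definition corner r S c : set (Rn R n) :=
  [set w | forall i, if i \in S then r < hcoord c w i else 0 <= hcoord c w i].

Lemma measurable_corner r S c : measurable (corner r S c).
Proof.
rewrite (_ : corner r S c = \bigcap_(i in [set: 'I_n.+1]) ((hcoord c ^~ i) @^-1`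
    (if i \in S then `]r, +oo[%classic else `[0, +oo[%classic))).
  apply: fin_bigcap_measurable; first exact: finite_finset.
  move=> i _; rewrite -[X in measurable X]setTI.
  by apply: measurable_hcoord => //; case: ifP.
apply/seteqP; split=> w /= Sw i => [_|].
  by have := Sw i; case: ifP => /= _; rewrite in_itv /= andbT.
by have := Sw i Logic.I; case: ifP => /= _; rewrite in_itv /= andbT.
Qed.

Lemma corner_ge0 r S c w i : 0 <= r -> corner r S c w -> 0 <= hcoord c w i.
Proof.
by move=> r0 /(_ i); case: ifP => // _; move/ltW; exact: le_trans.
Qed.

Lemma corner_le r S c w i : 0 <= r -> corner r S c w -> hcoord c w i <= c.
Proof.
move=> r0 Sw; rewrite -[leRHS](sum_hcoord c w) (bigD1 i)//= lerDl.
by apply: sumr_ge0 => j _; exact: corner_ge0 Sw.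
Qed.

(** Nonnegative coordinates of sum [c] are at most [c], so the corner lies in a
    box. *)
Lemma lebesgue_corner r S c : 0 <= r ->
  (lebesgue_Rn R n (corner r S c) < +oo)%E.
Proof.
move=> r0; pose B (i : 'I_n) : set (measurableTypeR R) := `[0, c]%classic.
have mB i : measurable (B i) by exact: measurable_itv.
apply: (@le_lt_trans _ _
    (lebesgue_Rn R n [set w | forall i, B i (tnth w i)])).
  apply: le_measure; rewrite ?inE.
  - exact: measurable_corner.
  - rewrite (_ : [set _ | _] =
        \bigcap_(i in [set: 'I_n]) ((@tnth n _)^~ i @^-1` B i)).
      apply: fin_bigcap_measurable; first exact: finite_finset.
      by move=> i _; rewrite -[X in measurable X]setTI; apply: measurable_tnth.
    by apply/seteqP; split=> [w Bw i _ //|w Bw i]; exact: Bw.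
  - move=> w Sw i; rewrite /B /= in_itv /= -(hcoord_widen c).
    by rewrite (corner_ge0 _ r0 Sw) (corner_le _ r0 Sw).
rewrite lebesgue_Rn_box// ltey_eq; apply/orP; left.
apply: (big_ind (fun x => x \is a fin_num)) => // [x y|i _].
  exact: fin_numM.
by rewrite /B lebesgue_measure_itv /=; case: ifP.
Qed.

Lemma bounded_measurable_hcoord r S c i : 0 <= r ->
  bounded_measurable (corner r S c) (hcoord c ^~ i).
Proof.
move=> r0; split; first by apply: measurable_funTS; exact: measurable_hcoord.
exists c => w Sw; rewrite ger0_norm ?(corner_ge0 _ r0 Sw)//.
exact: corner_le r0 Sw.
Qed.

(** Inclusion-exclusion, from the expansion of the product over [i] of
    1_(h_i >= 0) - 1_(h_i > 1), where the h_i are the coordinates of [w]. *)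
Lemma restrict_corner c (f : Rn R n -> R) w :
  (f \_ (cube_slice c)) w =
  \sum_(S : {set 'I_n.+1}) (-1) ^+ #|S| * (f \_ (corner 1 S c)) w.
Proof.
have restrictE A : (f \_ A) w = (w \in A)%:R * f w.
  by rewrite patchE; case: (w \in A); rewrite ?mul1r ?mul0r.
have indicE (b : 'I_n.+1 -> bool) :
    (asbool (forall i, b i))%:R = \prod_i (b i)%:R :> R.
  have [/asboolP ball|/asboolP nball] := boolP (asbool _).
    by rewrite big1// => i _; rewrite ball.
  have [i nbi] : exists i, ~~ b i.
    by apply/existsP; rewrite -negb_forall; apply/negP => /forallP.
  by rewrite (bigD1 i)//= (negbTE nbi) mul0r.
under eq_bigr do rewrite restrictE mulrA.
rewrite restrictE -mulr_suml; congr (_ * _).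
have -> : (w \in cube_slice c) = `[< forall i, 0 <= hcoord c w i <= 1 >].
  by apply/asboolP/asboolP => /(hcoordP c w (fun x => 0 <= x <= 1)).
rewrite indicE.
transitivity (\prod_i
    ((-1) * (1 < hcoord c w i)%R%:R + (0 <= hcoord c w i)%R%:R : R)).
  by apply: eq_bigr => i _; case: leP => h0; case: leP => h1 /=; lra.
rewrite bigA_distr; apply: eq_bigr => S _.
rewrite (_ : (w \in corner 1 S c) = `[< forall i,
    (if i \in S then 1 < hcoord c w i else 0 <= hcoord c w i) : bool >]).
  rewrite indicE -prodr_const [in RHS]big_mkcond -big_split/=.
  by apply: eq_bigr => i _; case: ifP => // _; rewrite mul1r.
by apply/asboolP/asboolP => Sw i; have := Sw i; case: ifP.
Qed.

End hyperplane.

(** * The exponent: counting pairs on the same side of a set *)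

Lemma sum_same_side (I : finType) (S : {set I}) :
  (\sum_(j : I) \sum_(i : I) ((i \in S) == (j \in S)) =
   (#|I| - #|S|) ^ 2 + #|S| ^ 2)%N.
Proof.
have -> : (#|I| - #|S| = #|~: S|)%N by rewrite [RHS]cardsCs finset.setCK.
transitivity (\sum_(j : I) if j \in S then #|S| else #|~: S|)%N.
  apply: eq_bigr => j _; rewrite -!sum1_card.
  by case: ifP => jS; rewrite [RHS]big_mkcond; apply: eq_bigr => i _;
    rewrite ?inE; case: (i \in S).
rewrite (bigID (mem S)) /= addnC; congr (_ + _)%N.
  under eq_bigr => j /negbTE-> do [].
  rewrite sum_nat_const -mulnn; congr (_ * _)%N.
  by apply: eq_card => j; rewrite !inE.
by under eq_bigr => j -> do []; rewrite sum_nat_const -mulnn.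
Qed.

Lemma sum_symmetric_pairs n (g : 'I_n -> 'I_n -> nat) :
  (forall i j, g i j = g j i) ->
  (\sum_(j < n) \sum_(i < n) g i j =
   \sum_(j < n) g j j + (\sum_(j < n) \sum_(i < n | i < j) g i j).*2)%N.
Proof.
move=> gC; rewrite -addnn addnA.
have {1}-> : (\sum_(j < n) \sum_(i < n | i < j) g i j =
    \sum_(j < n) \sum_(i < n | j < i) g i j)%N.
  rewrite (exchange_big_dep predT)//=.
  by apply: eq_bigr => j _; apply: eq_bigr => i _.
rewrite -!big_split /=; apply: eq_bigr => j _.
rewrite (bigD1 j) //= -addnA; congr (_ + _)%N.
rewrite (bigID (fun i : 'I_n => (j < i)%N)) /=.
congr (_ + _)%N; apply: eq_bigl => i.
  by case: ltngtP => [ji|//|//]; rewrite ?andbF// -val_eqE /= gtn_eqF.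
by rewrite -leqNgt ltn_neqAle.
Qed.

(** The ordered pairs on the same side number [(n.+1 - #|S|) ^ 2 + #|S| ^ 2], of
    which [n.+1] are diagonal; each unordered pair [i < j] accounts for two of
    the others. *)
Lemma sum_same_side_pairs n (S : {set 'I_n.+1}) :
  (n + \sum_(j < n.+1) \sum_(i < n.+1 | i < j)
         (if (i \in S) == (j \in S) then 2 else 0) =
   (n.+1 - #|S|) ^ 2 + #|S| ^ 2 - 1)%N.
Proof.
have := sum_same_side S; rewrite sum_symmetric_pairs; last first.
  by move=> i j; rewrite eq_sym.
rewrite card_ord => <-.
under [X in (_ = X + _ - 1)%N]eq_bigr do rewrite eqxx.
rewrite sum1_card card_ord addSn subn1 /=; congr (_ + _)%N.
rewrite -mul2n big_distrr /=; apply: eq_bigr => j _.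
by rewrite big_distrr /=; apply: eq_bigr => i _; case: eqP.
Qed.

(** * The integral of the squared Vandermonde over a corner *)

Section corner_integral.
Context (R : realType) (n : nat) (S : {set 'I_n.+1}).
Implicit Types (c t : R) (y w : Rn R n).

Lemma vandermonde_hyperplane c w :
  vandermonde_sqr n.+1 (on_hyperplane c w) =
  \prod_(j < n.+1) \prod_(i < n.+1 | (i < j)%N)
    (hcoord c w i - hcoord c w j) ^+ 2.
Proof. by []. Qed.

Lemma measurable_vandermonde c :
  measurable_fun setT
    (fun w : Rn R n => vandermonde_sqr n.+1 (on_hyperplane c w)).
Proof.
under eq_fun do rewrite vandermonde_hyperplane.
apply: measurable_prod => j _.
under eq_fun do rewrite big_mkcond.
apply: measurable_prod => i _; case: (_ < _)%N => //.
apply: measurable_funX; apply: measurable_funB; exact: measurable_hcoord.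
Qed.

Lemma bounded_measurable_vandermonde r c : 0 <= r ->
  bounded_measurable (corner r S c)
    (fun w : Rn R n => vandermonde_sqr n.+1 (on_hyperplane c w)).
Proof.
move=> r0; under eq_fun do rewrite vandermonde_hyperplane.
apply: bounded_measurable_prod => j _; apply: bounded_measurable_prod => i _.
have hij : bounded_measurable (corner r S c)
    (fun w => hcoord c w i - hcoord c w j).
  by apply: bounded_measurableB; exact: bounded_measurable_hcoord.
exact: (bounded_measurableM hij hij).
Qed.

Lemma vandermonde_ge0 c w : 0 <= vandermonde_sqr n.+1 (on_hyperplane c w).
Proof. by do 2!apply: prodr_ge0 => ? _; exact: sqr_ge0. Qed.

Let side (i : 'I_n.+1) : R := (i \in S)%:R.

Let sum_side : \sum_i side i = #|S|%:R.
Proof. by rewrite -natr_sum -sum1_card [in RHS]big_mkcond. Qed.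

Let shift_scale t : Rn R n -> Rn R n :=
  affine_Rn (fun j => side (widen_ord (leqnSn n) j)) t.

Let hcoord_shift_scale t y i :
  hcoord (#|S|%:R + t) (shift_scale t y) i = side i + t * hcoord 1 y i.
Proof. by rewrite -sum_side -hcoord_affine mulr1. Qed.

(** The squared Vandermonde at the point [1_S + t y], as a polynomial in [t]
    divided by the power of [t] that it visibly contains: only the factors with
    [i] and [j] on different sides of [S] keep the indeterminate. *)
Definition scaled_vandermonde y : {poly R} :=
  \prod_(j < n.+1) \prod_(i < n.+1 | (i < j)%N)
    if (i \in S) == (j \in S) then ((hcoord 1 y i - hcoord 1 y j) ^+ 2)%:P
    else ((hcoord 1 y i - hcoord 1 y j) *: 'X +
          ((i \in S)%:R - (j \in S)%:R)%:P) ^+ 2.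

Let vandermonde_shift_scale t y :
  vandermonde_sqr n.+1 (on_hyperplane (#|S|%:R + t) (shift_scale t y)) =
  t ^+ (\sum_(j < n.+1) \sum_(i < n.+1 | (i < j)%N)
          (if (i \in S) == (j \in S) then 2 else 0)) *
  (scaled_vandermonde y).[t].
Proof.
rewrite vandermonde_hyperplane horner_prod -prodrXr -big_split /=.
apply: eq_bigr => j _; rewrite horner_prod -prodrXr -big_split /=.
apply: eq_bigr => i _; rewrite !hcoord_shift_scale /side.
case: ifP => [/eqP->|_] /=.
  by rewrite hornerC; ring.
by rewrite horner_exp hornerD hornerZ hornerX hornerC; ring.
Qed.

Let preimage_corner t : 0 < t ->
  shift_scale t @^-1` corner 1 S (#|S|%:R + t) = corner 0 S 1.
Proof.
move=> t0; apply/seteqP; split=> y Sy i; have := Sy i;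
  rewrite hcoord_shift_scale /side; case: (i \in S).
- by rewrite ltrDl pmulr_rgt0.
- by rewrite add0r pmulr_rge0.
- by rewrite ltrDl pmulr_rgt0.
- by rewrite add0r pmulr_rge0.
Qed.

Let poly_family_scaled_vandermonde :
  poly_family (corner 0 S 1) scaled_vandermonde.
Proof.
apply: poly_family_prod => j _; apply: poly_family_prod => i _.
have bij : bounded_measurable (corner 0 S 1)
    (fun y : Rn R n => hcoord 1 y i - hcoord 1 y j).
  by apply: bounded_measurableB; exact: bounded_measurable_hcoord.
case: (_ == _).
  rewrite (_ : (fun y => _) = fun y => 0 *: 'X +
      ((hcoord 1 y i - hcoord 1 y j) ^+ 2)%:P); last first.
    by apply/funext => y; rewrite scale0r add0r.
  by apply: poly_family_affine;
    [exact: bounded_measurable_cst|exact: (bounded_measurableM bij bij)].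
by apply: poly_familyM; apply: poly_family_affine => //;
  exact: bounded_measurable_cst.
Qed.

(** After the substitution the domain is [corner 0 S 1], whatever [t]; this is
    why a single polynomial [G] works for all [t]. *)
Lemma Rintegral_corner : exists G : {poly R}, forall t, 0 < t ->
  \int[lebesgue_Rn R n]_(w in corner 1 S (#|S|%:R + t))
    vandermonde_sqr n.+1 (on_hyperplane (#|S|%:R + t) w) =
  t ^+ ((n.+1 - #|S|) ^ 2 + #|S| ^ 2 - 1) * G.[t].
Proof.
have [G GE] := Rintegral_poly_family (measurable_corner _ _ _)
  (lebesgue_corner S 1 (lexx 0)) poly_family_scaled_vandermonde.
exists G => t t0.
rewrite (Rintegral_affine_Rn (fun j => side (widen_ord (leqnSn n) j)) t0).
- rewrite preimage_corner//.
  under eq_Rintegral do rewrite vandermonde_shift_scale.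
  (* The Jacobian [t ^+ n] meets the power of [t] taken out of the integrand. *)
  rewrite RintegralZl ?GE ?mulrA -?exprD ?sum_same_side_pairs//.
    exact: measurable_corner.
  apply: bounded_measurable_integrable.
  + exact: measurable_corner.
  + exact: lebesgue_corner.
  + exact: bounded_measurable_horner.
- exact: measurable_corner.
- exact: measurable_vandermonde.
- exact: vandermonde_ge0.
Qed.

(** The excesses of the coordinates over the indicator of [S] are nonnegative
    with sum [c - #|S| <= 0], hence all vanish.  As the excesses on [S] are
    positive, [S] is empty and the point is the origin, where two coordinates
    coincide since there are at least two. *)
Lemma vandermonde_corner_eq0 c w : (0 < n)%N -> c <= #|S|%:R ->
  corner 1 S c w -> vandermonde_sqr n.+1 (on_hyperplane c w) = 0.
Proof.
move=> n0 cS Sw.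
have excess_ge0 i : 0 <= hcoord c w i - side i.
  by rewrite subr_ge0 /side; have := Sw i; case: ifP => // _ /ltW.
have excess_eq0 i : hcoord c w i = side i.
  apply: subr0_eq; move: (i) (erefl true).
  apply: psumr_eq0P => [j _|]; first exact: excess_ge0.
  apply/eqP; rewrite eq_le sumr_ge0 ?andbT//.
  by rewrite sumrB sum_hcoord sum_side subr_le0.
have h0 i : hcoord c w i = 0.
  by have := Sw i; rewrite excess_eq0 /side; case: (i \in S) => //; rewrite ltxx.
rewrite vandermonde_hyperplane (bigD1 ord_max)//= (bigD1 ord0)//=.
by rewrite !h0 subrr expr0n mul0r mul0r.
Qed.

End corner_integral.

(** * The integral over a slice of the cube *)

Lemma Rintegral_cube_slice (R : realType) n (c : R) :
  \int[lebesgue_Rn R n]_(w in cube_slice c)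
    vandermonde_sqr n.+1 (on_hyperplane c w) =
  \sum_(S : {set 'I_n.+1}) (-1) ^+ #|S| *
    \int[lebesgue_Rn R n]_(w in corner 1 S c)
      vandermonde_sqr n.+1 (on_hyperplane c w).
Proof.
set V := fun w : Rn R n => vandermonde_sqr n.+1 (on_hyperplane c w).
have intV (S : {set 'I_n.+1}) :
    (lebesgue_Rn R n).-integrable setT (EFin \o (V \_ (corner 1 S c))).
  rewrite -restrict_EFin.
  apply/(integrable_mkcond _ (measurable_corner 1 S c)).1.
  apply: bounded_measurable_integrable.
  - exact: measurable_corner.
  - exact: lebesgue_corner.
  - exact: bounded_measurable_vandermonde.
rewrite Rintegral_mkcond; under eq_Rintegral do rewrite restrict_corner.
rewrite Rintegral_sum//.
  by apply: eq_bigr => S _; rewrite RintegralZl// -Rintegral_mkcond.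
move=> S; rewrite (_ : _ \o _ = fun w =>
    (((-1) ^+ #|S|)%:E * (EFin \o (V \_ (corner 1 S c))) w)%E).
  exact: integrableZl.
by apply/funext.
Qed.

Theorem theorem1p6 (R : realType) (k : nat) (k_ge2 : (2 <= k)%N) :
  exists g : 'I_k -> {poly R}, forall c : R, 0 <= c <= k%:R ->
    gamma k c =
    \sum_(l < k | l%:R < c)
      'C(k, l)%:R ^+ 2 * (c - l%:R) ^+ ((k - l) ^ 2 + l ^ 2 - 1)
        * (g l).[c - l%:R].
Proof.
case: k k_ge2 => // n; rewrite ltnS => n_gt0.
have [G GE] := choice (@Rintegral_corner R n).
set A : R := ((n.+1`!)%:R * (barnesG n.+2)%:R ^+ 2)^-1.
exists (fun l : 'I_n.+1 => (A * (-1) ^+ l * ('C(n.+1, l)%:R ^+ 2)^-1) *: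
  \sum_(S : {set 'I_n.+1} | #|S| == l) G S).
move=> c /andP[_ cn].
pose T (l : nat) := \sum_(S : {set 'I_n.+1} | #|S| == l)
  \int[lebesgue_Rn R n]_(w in corner 1 S c)
    vandermonde_sqr n.+1 (on_hyperplane c w).
have T0 (l : nat) : c <= l%:R -> T l = 0.
  move=> cl; apply: big1 => S /eqP Sl.
  transitivity (\int[lebesgue_Rn R n]_(w in corner 1 S c) (0 : R)).
    apply: eq_Rintegral => w /set_mem.
    by apply: vandermonde_corner_eq0 => //; rewrite Sl.
  by rewrite Rintegral_cst ?mul0r//; exact: measurable_corner.
(* The full set is one set too many for the sum over [l < n.+1]; its term
   vanishes because [c <= n.+1]. *)
have Tn1 : \sum_(S : {set 'I_n.+1} | #|S| == n.+1) (-1) ^+ #|S| *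
    \int[lebesgue_Rn R n]_(w in corner 1 S c)
      vandermonde_sqr n.+1 (on_hyperplane c w) = 0.
  transitivity ((-1) ^+ n.+1 * T n.+1); last by rewrite T0 ?mulr0.
  by rewrite /T big_distrr /=; apply: eq_bigr => S /eqP->.
have gammaE : gamma n.+1 c = A * \sum_(l < n.+1) (-1) ^+ l * T l.
  rewrite /gamma -/A /= Rintegral_cube_slice; congr (_ * _).
  have cardS (S : {set 'I_n.+1}) : (#|S| < n.+2)%N.
    by rewrite ltnS -[leqRHS](card_ord n.+1) max_card.
  rewrite (partition_big (fun S => Ordinal (cardS S)) xpredT)//=.
  rewrite big_ord_recr/= [X in _ + X](_ : _ = 0) ?addr0//.
  apply: eq_bigr => l _; rewrite /T big_distrr /=.
  by apply: eq_big => [S|S /eqP/(congr1 val)/= ->].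
rewrite gammaE big_distrr /= [RHS]big_mkcond; apply: eq_bigr => l _.
case: ltP => lc; last by rewrite T0// !mulr0.
have C0 : 'C(n.+1, l)%:R != 0 :> R.
  by rewrite pnatr_eq0 -lt0n bin_gt0 ltnW.
rewrite hornerZ horner_sum /T.
have -> : \sum_(S : {set 'I_n.+1} | #|S| == l)
    \int[lebesgue_Rn R n]_(w in corner 1 S c)
      vandermonde_sqr n.+1 (on_hyperplane c w) =
  (c - l%:R) ^+ ((n.+1 - l) ^ 2 + l ^ 2 - 1) *
  \sum_(S : {set 'I_n.+1} | #|S| == l) (G S).[c - l%:R].
  rewrite big_distrr /=; apply: eq_bigr => S /eqP Sl.
  by rewrite -Sl -GE ?Sl ?subr_gt0// [l%:R + _]addrC subrK.
by field.
Qed.
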